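(* Let $\alpha>0$, $\beta\in\mathbb{R}$, $a\ge 0$ and $b\ge 0$ with $a+b>0$, and consider the function $$F(x)=\begin{cases}\left(1-\left(1-\beta\left(ax+\tfrac b2x^2\right)\right)^{1/\beta}\right)^{\alpha} & \text{if } \beta\neq 0,\\ \left(1-e^{-(ax+\frac b2x^2)}\right)^{\alpha} & \text{if } \beta=0.\end{cases}$$ (i) If $\beta\le 0$, then $F$ is a cumulative distribution function on $(0,\infty)$. (ii) If $\beta>0$ and $b\neq 0$, then $F$ is a cumulative distribution function on $(0,\psi)$, where $\psi=\frac1b\sqrt{a^2+\frac{2b}{\beta}}-\frac ab$. (iii) If $\beta>0$ and $b=0$, then $F$ is a cumulative distribution function on $(0,\psi)$, where $\psi=\frac{1}{a\beta}$.
   Context: Saying that $F$ is a cumulative distribution function on an interval $(0,c)$, $0<c\le\infty$, means that the function equal to $F$ on $(0,c)$, to $0$ on $(-\infty,0]$ and (if $c<\infty$) to $1$ on $[c,\infty)$ is the cumulative distribution function of a probability measure on $\mathbb{R}$. *)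

(* Defs.v *)
From HB Require Import structures.
From mathcomp Require Import all_boot all_order all_algebra.
From mathcomp Require Import all_classical all_reals all_analysis.

Set Implicit Arguments.
Unset Strict Implicit.
Unset Printing Implicit Defensive.

Import Order.TTheory GRing.Theory Num.Theory.
Import numFieldNormedType.Exports.

Local Open Scope ring_scope.

(* [powR] equals 1 at a negative base and a nonzero exponent.  On the intervals
   (0, c) considered here, both bases below are nonnegative, so this convention
   plays no role. *)
Definition Ffun (R : realType) (alpha beta a b : R) (x : R) : R :=
  if beta == 0
  then (1 - expR (- (a * x + b / 2 * x ^+ 2))) `^ alpha
  else (1 - (1 - beta * (a * x + b / 2 * x ^+ 2)) `^ (1 / beta)) `^ alpha.

(* Only the values of [F] on (0, c) matter; c = +oo is allowed. *)
Definition extend_on (R : realType) (c : \bar R) (F : R -> R) (x : R) : R :=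
  if x <= 0 then 0 else if (x%:E < c)%E then F x else 1.

(* This is [cdf] of the identity random variable on (R, P). *)
Definition is_cdf (R : realType) (G : R -> R) : Prop :=
  exists P : probability (measurableTypeR R) R,
    forall x : R, P `]-oo, x]%classic = (G x)%:E.

Definition is_cdf_on (R : realType) (c : \bar R) (F : R -> R) : Prop :=
  (0 < c)%E /\ is_cdf (extend_on c F).

(* Main.v *)
Require Import Defs.
From HB Require Import structures.
From mathcomp Require Import all_boot all_order all_algebra.
From mathcomp Require Import all_classical all_reals all_analysis.
From mathcomp Require Import ring lra.
Import Order.TTheory GRing.Theory Num.Theory.
Import numFieldNormedType.Exports.
Local Open Scope ring_scope.

(** A nondecreasing function with values in [0, 1] which attains every value of
    (0, 1) has no jump, so it is right-continuous with limits 0 and 1 at the two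
    infinities, hence a cumulative distribution function. The function at hand is
    (1 - exp (- L (H x))) ^ alpha with H x = a x + b x^2 / 2 and
    L t = - ln (1 - beta t) / beta (L t = t if beta = 0): L and H are
    nondecreasing, can be inverted explicitly, and psi is the solution of
    beta H psi = 1. *)

Section CdfOfOnto.
Context {R : realType} (G : R -> R).
Hypothesis G_nd : nondecreasing G.
Hypothesis G_itv : forall x, 0 <= G x <= 1.
Hypothesis G_onto : forall u : R, 0 < u < 1 -> exists x, G x = u.

Let G_ltW x y : G x < G y -> x < y.
Proof. by apply: contraTT; rewrite -!leNgt; exact: G_nd. Qed.

(** If G x < 1, a value u slightly above G x is attained at some y > x, and monotonicity confines G
    to [G x, u] between x and y. If G x = 1, G is constant to the right of x. *)
Lemma onto_right_continuous x : (G @ at_right x --> G x)%classic.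
Proof.
apply/cvgrPdist_le => e e0.
have /andP[Gx0 _] := G_itv x.
have [Gx1|Gx1] := ltP (G x) 1; last first.
  near=> y; have xy : x <= y by [].
  have := G_nd _ _ xy; have /andP[_ ?] := G_itv y; move=> ?.
  by rewrite (_ : G x - G y = 0) ?normr0 ?ltW//; lra.
(* The midpoint of G x and 1 keeps u below 1 for large e, so that u is attained. *)
pose u := Num.min (G x + e) ((G x + 1) / 2).
have xu : G x < u by rewrite lt_min; apply/andP; split; lra.
have u1 : u < 1 by rewrite gt_min; apply/orP; right; lra.
have ue : u <= G x + e by rewrite ge_min lexx.
have [|y Gy] := G_onto u; first by rewrite u1 (le_lt_trans Gx0 xu).
have xy : x < y by apply: G_ltW; rewrite Gy.
near=> z.
have Gxz : G x <= G z by apply: G_nd.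
have Gzy : G z <= G y.
  by apply: G_nd; apply: ltW; near: z; exact: nbhs_right_lt.
by rewrite distrC ger0_norm ?subr_ge0//; lra.
Unshelve. all: by end_near. Qed.

HB.instance Definition _ :=
  isCumulative.Build R _ R G G_nd onto_right_continuous.

Let G_cvgNy : (G @ -oo --> (0 : R))%classic.
Proof.
apply/cvgrPdist_le => e e0.
(* The cap 1 / 2 keeps the value inside (0, 1) for every e > 0. *)
have [|y Gy] := G_onto (Num.min e (1 / 2)).
  by rewrite lt_min gt_min e0; apply/andP; split; [|apply/orP; right]; lra.
near=> z; rewrite sub0r normrN; have /andP[Gz _] := G_itv z.
rewrite ger0_norm//; have : G z <= G y.
  by apply: G_nd; near: z; exact: (nbhs_ninfty_le (num_real y)).
by rewrite Gy le_min => /andP[].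
Unshelve. all: by end_near. Qed.

Let G_cvgy : (G @ +oo --> (1 : R))%classic.
Proof.
apply/cvgrPdist_le => e e0.
have [|y Gy] := G_onto (Num.max (1 - e) (1 / 2)).
  by rewrite lt_max gt_max; apply/andP; split;
    [apply/orP; right|apply/andP; split]; lra.
near=> z; have /andP[_ Gz] := G_itv z.
rewrite ger0_norm ?subr_ge0//; have : G y <= G z.
  by apply: G_nd; near: z; exact: (nbhs_pinfty_ge (num_real y)).
by rewrite Gy ge_max => /andP[? _]; lra.
Unshelve. all: by end_near. Qed.

HB.instance Definition _ := isCumulativeBounded.Build R 0 1 G G_cvgNy G_cvgy.

(** The witness is the Lebesgue-Stieltjes measure of G, under which the identity has cumulative
    distribution function G. *)
Lemma is_cdf_onto : is_cdf G.
Proof.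
exists (lebesgue_stieltjes_measure G : probability (measurableTypeR R) R) => x.
rewrite -(cdf_lebesgue_stieltjes_id G x).
by rewrite /cdf /distribution /pushforward preimage_id.
Qed.

End CdfOfOnto.

Section CumulativeHazard.
Context {R : realType} (beta : R).

(** Cumulative hazard of a generalized Pareto law: [expR (- cumhazard t)] is (1 - beta t)^(1/beta)
    if beta <> 0 and beta t < 1; beta = 0 is the limit case. *)
Definition cumhazard (t : R) : R :=
  if beta == 0 then t else - (ln (1 - beta * t) / beta).

Lemma cumhazard_homo (t s : R) : t <= s -> beta * t < 1 -> beta * s < 1 ->
  cumhazard t <= cumhazard s.
Proof.
rewrite /cumhazard => ts t1 s1; case: eqVneq => // b0.
have [bn|bp|/eqP] := ltgtP beta 0; last by rewrite (negbTE b0).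
(* A negative beta reverses the order twice, in beta t and in the division. *)
- rewrite lerN2 ler_wnM2r// ?invr_le0 ?(ltW bn)// ler_ln ?posrE ?subr_gt0//.
  by rewrite lerB// ler_wnM2l// ltW.
- rewrite lerN2 ler_pM2r ?invr_gt0// ler_ln ?posrE ?subr_gt0//.
  by rewrite lerB// ler_pM2l.
Qed.

Lemma cumhazard0 : cumhazard 0 = 0.
Proof. by rewrite /cumhazard mulr0 subr0 ln1 mul0r oppr0 if_same. Qed.

Lemma cumhazard_onto (s : R) : 0 < s ->
  exists t, [/\ 0 < t, beta * t < 1 & cumhazard t = s].
Proof.
move=> s0; rewrite /cumhazard; case: eqVneq => [->|b0].
  by exists s; rewrite mul0r ltr01.
(* Solving - ln (1 - beta t) / beta = s gives t = (1 - exp (- beta s)) / beta, whose numerator has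
   the sign of beta. *)
have E : beta * ((1 - expR (- (beta * s))) / beta) = 1 - expR (- (beta * s)).
  by rewrite mulrC divfK.
exists ((1 - expR (- (beta * s))) / beta); rewrite E; split.
- have [bn|bp|/eqP] := ltgtP beta 0; last by rewrite (negbTE b0).
    rewrite nmulr_lgt0 ?invr_lt0// subr_lt0 expR_gt1 oppr_gt0.
    by rewrite nmulr_rlt0.
  by rewrite divr_gt0// subr_gt0 expR_lt1 oppr_lt0 mulr_gt0.
- by rewrite gtrBl expR_gt0.
- by rewrite subKr expRK mulNr opprK mulrAC divff// mul1r.
Qed.

End CumulativeHazard.

Section QuadraticHazard.
Context {R : realType} (a b : R).
Hypotheses (a_ge0 : 0 <= a) (b_ge0 : 0 <= b) (ab_gt0 : 0 < a + b).

(** Cumulative hazard of the linear failure rate a + b x. *)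
Definition quad (x : R) : R := a * x + b / 2 * x ^+ 2.

Lemma quad_lt (x y : R) : 0 <= x -> x < y -> quad x < quad y.
Proof.
move=> x0 xy; rewrite -subr_gt0.
have -> : quad y - quad x = (y - x) * (a + b / 2 * (x + y)).
  by rewrite /quad; ring.
rewrite mulr_gt0 ?subr_gt0//.
have [a0|a0] := eqVneq a 0; last first.
  by rewrite ltr_pwDl ?lt_neqAle 1?eq_sym ?a0// mulr_ge0 ?divr_ge0//; lra.
move: ab_gt0; rewrite a0 !add0r => b0.
by rewrite mulr_gt0 ?divr_gt0//; lra.
Qed.

Lemma quad_ltE (x y : R) : 0 <= x -> 0 <= y -> (quad x < quad y) = (x < y).
Proof.
move=> x0 y0; have [xy|yx|->] := ltgtP x y; last exact: ltxx.
- exact: quad_lt.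
- by apply/negbTE; rewrite -leNgt ltW// quad_lt.
Qed.

Lemma quad_gt0 (x : R) : 0 < x -> 0 < quad x.
Proof.
by move/(quad_lt _ _ (lexx 0)); rewrite {1}/quad expr0n !mulr0 addr0.
Qed.

(* The positive root of the quadratic, rationalized so as to remain valid if
   b = 0. *)
Lemma quad_onto (t : R) : 0 < t -> exists2 x, 0 < x & quad x = t.
Proof.
move=> t0; pose r := Num.sqrt (a ^+ 2 + 2 * b * t).
have bt0 : 0 <= b * t by rewrite mulr_ge0// ltW.
have d0 : 0 < a ^+ 2 + 2 * b * t.
  have [a0|a0] := eqVneq a 0.
    move: ab_gt0; rewrite a0 add0r expr0n add0r => b0.
    by rewrite !mulr_gt0.
  have : 0 < a ^+ 2 by rewrite exprn_even_gt0.
  lra.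
have r0 : 0 < r by rewrite sqrtr_gt0.
have r2 : r ^+ 2 = a ^+ 2 + 2 * b * t by rewrite sqr_sqrtr// ltW.
have ar : a + r != 0 by rewrite gt_eqF// ltr_wpDl.
exists (2 * t / (a + r)); first by rewrite divr_gt0 ?mulr_gt0// ltr_wpDl.
rewrite /quad; apply: (mulIf (expf_neq0 2 ar)).
have -> : (a * (2 * t / (a + r)) + b / 2 * (2 * t / (a + r)) ^+ 2)
   * (a + r) ^+ 2 = t * (2 * a ^+ 2 + 2 * a * r + 2 * b * t) by field.
(* This turns the last factor into (a + r)^2. *)
have -> : 2 * b * t = r ^+ 2 - a ^+ 2 by rewrite r2; ring.
ring.
Qed.

End QuadraticHazard.

Section FfunCdf.
Context {R : realType} (alpha beta a b : R).
Hypotheses (alpha_gt0 : 0 < alpha) (a_ge0 : 0 <= a) (b_ge0 : 0 <= b)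
  (ab_gt0 : 0 < a + b).

Local Notation H := (quad a b).

(** The base 1 - beta H x is positive, so [powR] is the exponential of a multiple of its
    logarithm. *)
Lemma FfunE x : beta * H x < 1 ->
  Ffun alpha beta a b x = (1 - expR (- cumhazard beta (H x))) `^ alpha.
Proof.
move=> x1; rewrite /Ffun /cumhazard; case: eqVneq => // b0.
congr ((1 - _) `^ _).
by rewrite /powR gt_eqF ?subr_gt0// opprK mul1r mulrC.
Qed.

Let H_gt0 := quad_gt0 a b a_ge0 b_ge0 ab_gt0.

Lemma cumhazard_quad_ge0 (x : R) : 0 < x -> beta * H x < 1 ->
  0 <= cumhazard beta (H x).
Proof.
move=> x0 x1; rewrite -(cumhazard0 beta) cumhazard_homo ?mulr0//.
by rewrite ltW// H_gt0.
Qed.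

(** Common form of the three cases: c is the point where beta H reaches 1, or +oo if it never
    does. *)
Lemma is_cdf_on_Ffun (c : \bar R) : (0 < c)%E ->
  (forall x : R, 0 < x -> (x%:E < c)%E = (beta * H x < 1)) ->
  is_cdf_on c (Ffun alpha beta a b).
Proof.
move=> c0 cP; split=> //.
have base_ge0 (x : R) : 0 < x -> beta * H x < 1 ->
    0 <= 1 - expR (- cumhazard beta (H x)) <= 1.
  move=> x0 x1; rewrite subr_ge0 -expR0 ler_expR oppr_le0.
  by rewrite cumhazard_quad_ge0// expR0 gerBl expR_ge0.
have F_itv (x : R) : 0 < x -> beta * H x < 1 ->
    0 <= Ffun alpha beta a b x <= 1.
  move=> x0 x1; have /andP[f0 f1] := base_ge0 x x0 x1.
  rewrite FfunE// powR_ge0 /=.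
  rewrite -[leRHS](_ : 1 `^ alpha = 1); last by rewrite powR1.
  by rewrite ge0_ler_powR ?nnegrE// ltW.
have G_itv x : 0 <= extend_on c (Ffun alpha beta a b) x <= 1.
  rewrite /extend_on; case: ifPn => [_|]; first by rewrite lexx ler01.
  rewrite -ltNge => x0; case: ifPn => [|_]; last by rewrite ler01 lexx.
  by rewrite cP//; exact: F_itv.
apply: is_cdf_onto; [|exact: G_itv|].
- move=> x y xy; have [x0|x0] := leP x 0.
    by rewrite {1}/extend_on x0; have /andP[] := G_itv y.
  have y0 : 0 < y := lt_le_trans x0 xy.
  have [yc|yc] := boolP (y%:E < c)%E; last first.
    rewrite {2}/extend_on (leNgt y) y0 (negbTE yc)/=.
    by have /andP[] := G_itv x.
  have xc : (x%:E < c)%E by apply: le_lt_trans yc; rewrite lee_fin.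
  rewrite /extend_on (leNgt x) (leNgt y) x0 y0 xc yc/=.
  have x1 : beta * H x < 1 by rewrite -cP.
  have y1 : beta * H y < 1 by rewrite -cP.
  rewrite (FfunE _ x1) (FfunE _ y1).
  have /andP[? _] := base_ge0 _ x0 x1; have /andP[? _] := base_ge0 _ y0 y1.
  rewrite (ge0_ler_powR (ltW alpha_gt0)) ?nnegrE// lerB// ler_expR lerN2.
  rewrite cumhazard_homo//; have [->//|xny] := eqVneq x y.
  by rewrite ltW// quad_lt ?(ltW x0)// lt_neqAle xny.
(* A preimage of u is found by undoing the layers from outside in: the power alpha, the exponential,
   [cumhazard], then H. *)
- move=> u /andP[u0 u1].
  have v1 : u `^ alpha^-1 < 1.
    rewrite -[ltRHS](_ : 1 `^ alpha^-1 = 1); last by rewrite powR1.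
    by rewrite gt0_ltr_powR ?invr_gt0 ?nnegrE ?ler01 ?ltW.
  have v0 : 0 < u `^ alpha^-1 by rewrite powR_gt0.
  have [|t [t0 t1 tE]] := cumhazard_onto beta (- ln (1 - u `^ alpha^-1)).
    by rewrite oppr_gt0 ln_lt0// subr_gt0 v1 gtrBl v0.
  have [x x0 xE] := quad_onto a b a_ge0 b_ge0 ab_gt0 t t0.
  exists x; rewrite /extend_on (leNgt x) x0/= cP// xE t1 FfunE ?xE// tE opprK.
  rewrite lnK ?posrE ?subr_gt0// subKr -powRrM mulVf ?gt_eqF//.
  by rewrite powRr1// ltW.
Qed.

Lemma is_cdf_on_Ffun_fin (psi : R) : 0 < beta -> 0 < psi ->
  beta * H psi = 1 -> is_cdf_on psi%:E (Ffun alpha beta a b).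
Proof.
move=> beta0 psi0 psi1; apply: is_cdf_on_Ffun; first by rewrite lte_fin.
by move=> x x0; rewrite lte_fin -psi1 ltr_pM2l// quad_ltE ?(ltW x0) ?(ltW psi0).
Qed.

End FfunCdf.

Theorem theorem2p1 (R : realType) (alpha beta a b : R)
    (alpha_gt0 : 0 < alpha) (a_ge0 : 0 <= a) (b_ge0 : 0 <= b)
    (ab_gt0 : 0 < a + b) :
  [/\ (beta <= 0 -> is_cdf_on +oo%E (Ffun alpha beta a b)),
      (0 < beta -> b != 0 ->
         is_cdf_on (1 / b * Num.sqrt (a ^+ 2 + 2 * b / beta) - a / b)%:E
           (Ffun alpha beta a b)) &
      (0 < beta -> b = 0 ->
         is_cdf_on (1 / (a * beta))%:E (Ffun alpha beta a b))].
Proof.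
split=> [beta0|beta0 b0|beta0 b0].
- apply: is_cdf_on_Ffun => // x x0; rewrite ltry; apply/esym.
  rewrite (le_lt_trans _ ltr01)// mulr_le0_ge0// ltW//.
  exact: quad_gt0.
- have bp : 0 < b by rewrite lt_neqAle eq_sym b0.
  have db : 0 < 2 * b / beta by rewrite divr_gt0// mulr_gt0.
  have a2 := sqr_ge0 a.
  set r := Num.sqrt _.
  have r2 : r ^+ 2 = a ^+ 2 + 2 * b / beta by rewrite sqr_sqrtr//; lra.
  (* The endpoint is (r - a) / b, so this gives its positivity. *)
  have ar : a < r.
    rewrite -(ltr_pXn2r (n := 2))// ?nnegrE ?sqrtr_ge0// r2; lra.
  apply: is_cdf_on_Ffun_fin => //.
    by rewrite mul1r mulrC -mulrBl divr_gt0// subr_gt0.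
  have -> : beta * quad a b (1 / b * r - a / b) =
      beta * (r ^+ 2 - a ^+ 2) / (2 * b) by rewrite /quad; field.
  by rewrite r2; field; rewrite b0 gt_eqF.
- have ap : 0 < a by lra.
  apply: is_cdf_on_Ffun_fin => //.
    by rewrite divr_gt0// mulr_gt0.
  by rewrite /quad b0; field; rewrite !gt_eqF.
Qed.
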